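(* Let $(X,\mathbb{A},d)$ be a complete $C^*$-algebra valued asymmetric metric space and let $T:X\to X$ be a forward $C^*$-algebra valued contractive mapping, i.e. there exists $a\in\mathbb{A}$ with $\|a\|<1$ such that $d(Tx,Ty)\preceq a^*\,d(x,y)\,a$ for all $x,y\in X$. Then $T$ has a unique fixed point in $X$.
   Context: $\mathbb{A}$ is a unital $C^*$-algebra with unit $I_{\mathbb{A}}$ and zero $0_{\mathbb{A}}$; $\mathbb{A}^+$ denotes its positive elements and, for self-adjoint $a,b$, $a\preceq b$ means $b-a\in\mathbb{A}^+$. $\epsilon\succ 0_{\mathbb{A}}$ means $\epsilon\in\mathbb{A}^+$ is invertible (equivalently $\epsilon\succeq\delta I_{\mathbb{A}}$ for some real $\delta>0$). A $C^*$-algebra valued asymmetric metric on a nonempty set $X$ is a map $d:X\times X\to\mathbb{A}$ such that (i) $0_{\mathbb{A}}\preceq d(x,y)$ for all $x,y$, and $d(x,y)=0_{\mathbb{A}}$ iff $x=y$; (ii) $d(x,y)\preceq d(x,z)+d(z,y)$ for all $x,y,z$ (symmetry not required); $(X,\mathbb{A},d)$ is then a $C^*$-algebra valued asymmetric metric space. A sequence $\{x_n\}$ forward converges to $x$ if for every $\epsilon\succ0_{\mathbb{A}}$ there is $k$ with $d(x,x_n)\preceq\epsilon$ for all $n\ge k$; it backward converges to $x$ if for every $\epsilon\succ0_{\mathbb{A}}$ there is $k$ with $d(x_n,x)\preceq\epsilon$ for all $n\ge k$. $\{x_n\}$ is forward Cauchy if for every $\epsilon\succ0_{\mathbb{A}}$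 there is $k$ with $d(x_p,x_n)\preceq\epsilon$ for all $n>p\ge k$; it is backward Cauchy if for every $\epsilon\succ0_{\mathbb{A}}$ there is $k$ with $d(x_n,x_p)\preceq\epsilon$ for all $n>p\ge k$. $X$ is forward (resp. backward) complete if every forward (resp. backward) Cauchy sequence forward (resp. backward) converges to some point of $X$; $X$ is complete if it is both forward and backward complete. *)

(* Defs.v *)
From mathcomp Require Import all_boot all_order all_algebra.
From mathcomp Require Import reals.
From mathcomp.real_closed Require Import complex.
Set Implicit Arguments. Unset Strict Implicit. Unset Printing Implicit Defensive.
Import GRing.Theory Num.Theory.
Local Open Scope ring_scope.
Local Open Scope complex_scope.

Section CStar.
Variables (R : realType) (A : algType R[i]) (star : A -> A) (nrm : A -> R).

Record is_unital_CStar : Prop := {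
  star_add   : forall x y, star (x + y) = star x + star y;
  star_scale : forall (c : R[i]) x, star (c *: x) = c^* *: star x;
  star_mul   : forall x y, star (x * y) = star y * star x;
  star_invol : forall x, star (star x) = x;
  nrm_ge0    : forall x, 0 <= nrm x;
  nrm_eq0    : forall x, nrm x = 0 -> x = 0;
  nrm_add    : forall x y, nrm (x + y) <= nrm x + nrm y;
  nrm_scale  : forall (c : R[i]) x, (nrm (c *: x))%:C = `|c| * (nrm x)%:C;
  nrm_mul    : forall x y, nrm (x * y) <= nrm x * nrm y;
  nrm_one    : nrm 1 = 1;
  cstar_id   : forall x, nrm (star x * x) = nrm x ^+ 2;
  nrm_complete : forall u : nat -> A,
    (forall e : R, 0 < e -> exists N, forall m n, (N <= m)%N -> (N <= n)%N ->
        nrm (u m - u n) < e) ->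
    exists l : A, forall e : R, 0 < e -> exists N, forall n, (N <= n)%N ->
        nrm (u n - l) < e
}.

Definition invertible (x : A) : Prop := exists y : A, x * y = 1 /\ y * x = 1.

Definition cpos (x : A) : Prop :=
  star x = x /\
  forall lam : R[i], ~ invertible (x - lam *: 1) -> 0 <= lam.

Definition cle (x y : A) : Prop := cpos (y - x).

Definition cgt0 (eps : A) : Prop := cpos eps /\ invertible eps.

Section Metric.
Variables (X : Type) (d : X -> X -> A).

Definition asym_metric : Prop :=
  (forall x y, cpos (d x y)) /\
  (forall x y, d x y = 0 <-> x = y) /\
  (forall x y z, cle (d x y) (d x z + d z y)).

Definition fwd_conv (u : nat -> X) (x : X) : Prop :=
  forall eps, cgt0 eps -> exists k, forall n, (k <= n)%N -> cle (d x (u n)) eps.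
Definition bwd_conv (u : nat -> X) (x : X) : Prop :=
  forall eps, cgt0 eps -> exists k, forall n, (k <= n)%N -> cle (d (u n) x) eps.
Definition fwd_cauchy (u : nat -> X) : Prop :=
  forall eps, cgt0 eps -> exists k, forall n p, (k <= p)%N -> (p < n)%N ->
    cle (d (u p) (u n)) eps.
Definition bwd_cauchy (u : nat -> X) : Prop :=
  forall eps, cgt0 eps -> exists k, forall n p, (k <= p)%N -> (p < n)%N ->
    cle (d (u n) (u p)) eps.

Definition fwd_complete : Prop :=
  forall u, fwd_cauchy u -> exists x, fwd_conv u x.
Definition bwd_complete : Prop :=
  forall u, bwd_cauchy u -> exists x, bwd_conv u x.
Definition complete_space : Prop := fwd_complete /\ bwd_complete.

Definition fwd_contraction (T : X -> X) : Prop :=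
  exists a : A, nrm a < 1 /\ forall x y, cle (d (T x) (T y)) (star a * d x y * a).

End Metric.
End CStar.

(* Main.v *)
(** The real function D x y := |d x y| is again an asymmetric metric, with the
    same notions of convergence and Cauchy sequence, and T contracts it by the
    factor |a|^2.  The orbit of any point is therefore both forward and backward
    Cauchy; its forward limit x and its backward limit y agree because
    D x y <= D x u_n + D u_n y, and the two-sided limit is fixed by T.

    That D inherits these properties rests on the order and the norm being
    compatible, which follows from one fact: if x is self-adjoint and
    q := |x|^2 > 0, then q - x^2 is not invertible.  Otherwise, for small e > 0,
    q + e - x^2 has a self-adjoint square root and an inverse v bounded uniformly
    in e, so q - e - x^2 = (q + e - x^2)(1 - 2ev) has a self-adjoint square
    root k commuting with x.  Then (x + ik)^*(x + ik) = q - e, and x is the real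
    part of x + ik, so |x|^2 <= q - e, a contradiction. *)

Require Import Defs.
From mathcomp Require Import all_boot all_order all_algebra.
From mathcomp Require Import reals.
From mathcomp.real_closed Require Import complex.
From mathcomp Require Import lra ring.
From Stdlib Require Import Classical.

Set Implicit Arguments. Unset Strict Implicit. Unset Printing Implicit Defensive.
Import Order.TTheory GRing.Theory Num.Theory.
Local Open Scope ring_scope.
Local Open Scope complex_scope.

(** * Geometric decay of real sequences *)

Section GeometricSequences.
Variable R : realType.

Lemma geometric_small (r c e : R) : 0 <= r -> r < 1 -> 0 <= c -> 0 < e ->
  exists N, forall n, (N <= n)%N -> c * r ^+ n < e.
Proof.
move=> r0 r1 c0 e0.
(* A Bernoulli inequality: it forces [r ^+ n] to decay like 1/n, so the Archimedean property
   supplies the threshold. *)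
have bernoulli n : r ^+ n * (1 + n%:R * (1 - r)) <= 1.
  elim: n => [|n IH]; first by rewrite expr0 mul0r addr0 mulr1.
  have rn : 0 <= r ^+ n by exact: exprn_ge0.
  have n0 : 0 <= n%:R :> R by exact: ler0n.
  apply: le_trans IH; rewrite exprS -natr1.
  rewrite [r * _]mulrC -mulrA; apply: ler_wpM2l => //.
  rewrite -subr_ge0.
  have -> : 1 + n%:R * (1 - r) - r * (1 + (n%:R + 1) * (1 - r)) =
     (n%:R + 1) * ((1 - r) * (1 - r)) by ring.
  by rewrite mulr_ge0 ?mulr_ge0 ?subr_ge0 ?addr_ge0 // ltW.
pose b := c / (e * (1 - r)).
have d0 : 0 < e * (1 - r) by rewrite mulr_gt0 // subr_gt0.
have b0 : 0 <= b by rewrite divr_ge0 // ltW.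
exists (Num.bound b) => n le_n.
have lt_b : b < n%:R by apply: lt_le_trans (archi_boundP b0) _; rewrite ler_nat.
move: lt_b; rewrite /b ltr_pdivrMr // => lt_c.
have den0 : 0 < 1 + n%:R * (1 - r).
  by rewrite ltr_wpDr ?mulr_ge0 ?subr_ge0 // ltW.
rewrite -(ltr_pM2r den0) -mulrA.
apply: le_lt_trans (_ : c < _); last by nra.
by rewrite ler_piMr.
Qed.

(** Only growth in the second index is assumed of [D], so the lemma serves the norm distance and
    both directions of an asymmetric metric. *)
Lemma geometric_cauchy (D : nat -> nat -> R) (r c : R) :
  0 <= r -> r < 1 -> 0 <= c -> (forall p, D p p = 0) ->
  (forall p n, (p <= n)%N -> D p n.+1 <= D p n + c * r ^+ n) ->
  forall e, 0 < e ->
    exists N, forall p n, (N <= p)%N -> (p <= n)%N -> D p n < e.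
Proof.
move=> r0 r1 c0 Dpp Dstep e e0.
(* Partial geometric sum, multiplied by [1 - r] to avoid division. *)
have bound p m : D p (p + m)%N * (1 - r) <= c * r ^+ p * (1 - r ^+ m).
  elim: m => [|m IH]; first by rewrite addn0 Dpp mul0r expr0 subrr mulr0.
  have := Dstep p (p + m)%N (leq_addr _ _); rewrite -addnS exprD => step.
  rewrite exprS.
  have : D p (p + m.+1)%N * (1 - r) <=
      (D p (p + m)%N + c * (r ^+ p * r ^+ m)) * (1 - r).
    by rewrite ler_wpM2r // subr_ge0 ltW.
  lra.
have e1 : 0 < e * (1 - r) by rewrite mulr_gt0 // subr_gt0.
have [N HN] := geometric_small r0 r1 c0 e1.
exists N => p n Np pn; rewrite -(subnKC pn).
have r1' : 0 < 1 - r by rewrite subr_gt0.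
rewrite -(ltr_pM2r r1'); apply: le_lt_trans (HN p Np).
apply: le_trans (bound _ _) _.
by rewrite ler_piMr ?mulr_ge0 ?exprn_ge0 // gerBl exprn_ge0.
Qed.

End GeometricSequences.

(** * Norm, involution and real scalars in a unital C*-algebra *)

Section CStarTheory.
Variables (R : realType) (A : algType R[i]) (star : A -> A) (nrm : A -> R).
Hypothesis HA : is_unital_CStar star nrm.

Lemma nrm0 : nrm 0 = 0.
Proof.
apply: (@complexI R); have := nrm_scale HA 0 0.
by rewrite scale0r normr0 mul0r.
Qed.

Lemma nrmZ (r : R) x : nrm (r%:C *: x) = `|r| * nrm x.
Proof.
apply: (@complexI R); rewrite (nrm_scale HA) rmorphM; congr (_ * _).
by rewrite normc_def /= expr0n addr0 sqrtr_sqr.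
Qed.

Lemma nrmZi x : nrm ('i%C *: x) = nrm x.
Proof.
apply: (@complexI R); rewrite (nrm_scale HA).
by rewrite normc_def /= expr0n add0r expr1n sqrtr1 mul1r.
Qed.

Lemma nrmN x : nrm (- x) = nrm x.
Proof.
have := nrmZ (-1) x; rewrite normrN1 mul1r => <-.
by rewrite raddfN /= scaleN1r.
Qed.

Lemma nrmB x y : nrm (x - y) = nrm (y - x).
Proof. by rewrite -nrmN opprB. Qed.

Lemma starN x : star (- x) = - star x.
Proof. by rewrite -scaleN1r (star_scale HA) rmorphN rmorph1 scaleN1r. Qed.

Lemma starB x y : star (x - y) = star x - star y.
Proof. by rewrite (star_add HA) starN. Qed.

Lemma star1 : star 1 = 1.
Proof.
by have := star_mul HA (star 1) 1; rewrite mulr1 (star_invol HA) mulr1.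
Qed.

Lemma nrm_star x : nrm (star x) = nrm x.
Proof.
(* The C*-identity gives |y|^2 = |y^* y| <= |y^*| |y|; the reverse inequality is the case of
   [star x]. *)
suff le_star y : nrm y <= nrm (star y).
  by apply/eqP; rewrite eq_le -{2}(star_invol HA x) !le_star.
have [->|y0] := eqVneq (nrm y) 0; first exact: (nrm_ge0 HA).
have y1 : 0 < nrm y by rewrite lt_neqAle eq_sym y0 (nrm_ge0 HA).
rewrite -(ler_pM2r y1) -expr2 -(cstar_id HA); exact: (nrm_mul HA).
Qed.

Definition sc (r : R) : A := r%:C *: 1.

Lemma scD r s : sc (r + s) = sc r + sc s.
Proof. by rewrite /sc raddfD scalerDl. Qed.
Lemma scN r : sc (- r) = - sc r.
Proof. by rewrite /sc raddfN scaleNr. Qed.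
Lemma scB r s : sc (r - s) = sc r - sc s.
Proof. by rewrite scD scN. Qed.
Lemma scM r s : sc (r * s) = sc r * sc s.
Proof. by rewrite /sc rmorphM -scalerAl mul1r scalerA. Qed.
Lemma sc1 : sc 1 = 1.
Proof. by rewrite /sc rmorph1 scale1r. Qed.
Lemma sc_comm r x : sc r * x = x * sc r.
Proof. by rewrite /sc -scalerAl -scalerAr mul1r mulr1. Qed.
Lemma star_sc r : star (sc r) = sc r.
Proof. by rewrite /sc (star_scale HA) star1; congr (_ *: _); exact: conjc_real. Qed.
Lemma nrm_scM r x : nrm (sc r * x) = `|r| * nrm x.
Proof. by rewrite /sc -scalerAl mul1r nrmZ. Qed.
Lemma nrm_sc r : nrm (sc r) = `|r|.
Proof. by rewrite /sc nrmZ (nrm_one HA) mulr1. Qed.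

(** * Norm limits and fixed points, and the inverses and square roots they give *)

Definition nconv (u : nat -> A) (l : A) : Prop :=
  forall e : R, 0 < e -> exists N, forall n, (N <= n)%N -> nrm (u n - l) < e.

Lemma nconv_eq0 u l z c : nconv u l ->
  (forall n, nrm z <= c * nrm (u n - l)) -> z = 0.
Proof.
move=> ul Hz; apply: (nrm_eq0 HA); apply/eqP; rewrite eq_le (nrm_ge0 HA) andbT.
rewrite leNgt; apply/negP => z0.
have c1 : 0 < `|c| + 1 by rewrite ltr_wpDl.
have [N HN] := ul (nrm z / (`|c| + 1)) (divr_gt0 z0 c1).
have := HN N (leqnn N); rewrite ltr_pdivlMr //.
have := Hz N; have := ler_norm c; have := nrm_ge0 HA (u N - l); nra.
Qed.

(** Banach's principle on the closed set [P]. Carrying extra properties in [P] lets the fixed point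
    inherit them. *)
Lemma contraction_fixpoint (P : A -> Prop) (F : A -> A) (r : R) (z0 : A) :
  (forall u l, (forall n, P (u n)) -> nconv u l -> P l) ->
  0 <= r -> r < 1 -> P z0 -> (forall z, P z -> P (F z)) ->
  (forall z w, P z -> P w -> nrm (F z - F w) <= r * nrm (z - w)) ->
  exists l, P l /\ F l = l.
Proof.
move=> Pclosed r0 r1 Pz0 PF Fcontr.
pose u n := iter n F z0.
have Pu n : P (u n) by elim: n => //= n; exact: PF.
have step n : nrm (u n.+1 - u n) <= nrm (F z0 - z0) * r ^+ n.
  elim: n => [|n IH]; first by rewrite expr0 mulr1.
  apply: le_trans (Fcontr _ _ (Pu n.+1) (Pu n)) _.
  by rewrite exprS mulrCA ler_wpM2l.
have [|l ul] := nrm_complete HA (u := u).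
  move=> e e0.
  have [|||N HN] := @geometric_cauchy R (fun p n => nrm (u n - u p))
      r (nrm (F z0 - z0)) r0 r1 _ _ _ e e0.
  - exact: (nrm_ge0 HA).
  - by move=> p; rewrite subrr nrm0.
  - move=> p n _; apply: le_trans (_ : nrm (u n.+1 - u n) + nrm (u n - u p) <= _).
      by apply: le_trans (nrm_add HA _ _); rewrite addrA subrK.
    by rewrite addrC lerD2l.
  exists N => m n Nm Nn; have [mn|nm] := leqP m n.
    by rewrite nrmB; exact: HN.
  by apply: HN => //; exact: ltnW.
exists l; have Pl : P l by exact: Pclosed ul.
split=> //; apply/eqP; rewrite -subr_eq0; apply/eqP.
apply: (nrm_eq0 HA); apply/eqP; rewrite eq_le (nrm_ge0 HA) andbT.
rewrite leNgt; apply/negP => z0'.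
(* Two errors, each below half of |F l - l|, bound |F l - l| itself. *)
have [N HN] := ul _ (divr_gt0 z0' (ltr0Sn R 1)).
have h1 := HN N (leqnn N); have h2 := HN N.+1 (leqnSn N).
have h3 := Fcontr _ _ Pl (Pu N); rewrite (nrmB l) in h3.
have h4 : nrm (F l - l) <= nrm (F l - u N.+1) + nrm (u N.+1 - l).
  by apply: le_trans (nrm_add HA _ _); rewrite addrA subrK.
have := nrm_ge0 HA (u N - l).
rewrite [u N.+1]/= in h1 h2 h3 h4.
nra.
Qed.

(** The fixed points of z -> 1 + yz and z -> 1 + zy are a right and a left inverse, which must
    coincide. *)
Lemma neumann y : nrm y < 1 -> invertible (1 - y).
Proof.
move=> y1; have y0 := nrm_ge0 HA y.
have [||z [_ Hz]] := @contraction_fixpoint (fun _ => True)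
  (fun z => 1 + y * z) (nrm y) 0 _ y0 y1 I (fun _ _ => I) _.
  by [].
  by move=> z w _ _; rewrite /= opprD addrACA subrr add0r -mulrBr; exact: (nrm_mul HA).
have [||w [_ Hw]] := @contraction_fixpoint (fun _ => True)
  (fun z => 1 + z * y) (nrm y) 0 _ y0 y1 I (fun _ _ => I) _.
  by [].
  by move=> w w' _ _; rewrite /= opprD addrACA subrr add0r -mulrBl [nrm y * _]mulrC; exact: (nrm_mul HA).
have rz : (1 - y) * z = 1 by rewrite mulrBl mul1r -{1}Hz addrK.
have lw : w * (1 - y) = 1 by rewrite mulrBr mulr1 -{1}Hw addrK.
exists z; split=> //.
by rewrite -{2}lw -[w in RHS]mulr1 -rz mulrA lw mul1r.
Qed.

(** If z = (y + z^2)/2 then (1 - z)^2 = 1 - y. On the ball of radius |y| this map is a contraction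
    of factor |y|, and it preserves self-adjointness and commutation with everything that commutes
    with y. *)
Lemma selfadjoint_sqrt1 y : star y = y -> nrm y < 1 ->
  exists h, [/\ star h = h, h * h = 1 - y &
    forall z, z * y = y * z -> z * h = h * z].
Proof.
move=> sy y1; have y0 := nrm_ge0 HA y.
pose P z := [/\ nrm z <= nrm y, star z = z & forall w, w * y = y * w -> w * z = z * w].
have [|||z w [z1 _ _] [w1 _ _]|z [[z1 sz cz] Fz]] :=
    @contraction_fixpoint P (fun z => sc 2^-1 * (y + z * z)) (nrm y) 0 _ y0 y1.
- move=> u l Pu ul; split.
  + rewrite leNgt; apply/negP => ly.
    have [|N /(_ N (leqnn N))] := ul (nrm l - nrm y); first by rewrite subr_gt0.
    have [uN _ _] := Pu N; rewrite nrmB => ?.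
    have := nrm_add HA (l - u N) (u N); rewrite subrK; lra.
  + apply/eqP; rewrite -subr_eq0; apply/eqP; apply: (nconv_eq0 (c := 2) ul) => n.
    have [_ sn _] := Pu n.
    have -> : star l - l = (u n - l) - star (u n - l).
      by rewrite starB sn opprB [RHS]addrC addrA subrK.
    by apply: le_trans (nrm_add HA _ _) _; rewrite nrmN nrm_star; lra.
  + move=> w wy; apply/eqP; rewrite -subr_eq0; apply/eqP.
    apply: (nconv_eq0 (c := 2 * nrm w) ul) => n.
    have [_ _ /(_ w wy) cn] := Pu n.
    have -> : w * l - l * w = (u n - l) * w - w * (u n - l).
      by rewrite mulrBl mulrBr cn opprB [RHS]addrC addrA subrK.
    apply: le_trans (nrm_add HA _ _) _; rewrite nrmN.
    have := nrm_mul HA (u n - l) w; have := nrm_mul HA w (u n - l); lra.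
- split=> [||w _]; rewrite ?nrm0 ?mulr0 ?mul0r //.
  by rewrite -[RHS](subrr (star 0)) -starB subrr.
- move=> z [z1 sz cz]; split.
  + rewrite nrm_scM ger0_norm ?invr_ge0 //.
    have := nrm_add HA y (z * z); have := nrm_mul HA z z.
    have := nrm_ge0 HA z; nra.
  + by rewrite (star_mul HA) star_sc (star_add HA) (star_mul HA) sy sz sc_comm.
  + move=> w wy; rewrite mulrA -sc_comm -!mulrA mulrDr mulrDl wy.
    by rewrite mulrA (cz w wy) -!mulrA (cz w wy).
- rewrite -mulrBr opprD addrACA subrr add0r nrm_scM ger0_norm ?invr_ge0 //.
  (* This splitting is valid without commutation of [z] and [w]. *)
  have -> : z * z - w * w = z * (z - w) + (z - w) * w.
    by rewrite mulrBl mulrBr addrA subrK.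
  have := nrm_add HA (z * (z - w)) ((z - w) * w).
  have := nrm_mul HA z (z - w); have := nrm_mul HA (z - w) w.
  have := nrm_ge0 HA (z - w); nra.
exists (1 - z); split.
- by rewrite starB star1 sz.
- have zz : z + z = y + z * z.
    rewrite -{1 2}Fz -mulrDl -scD.
    by have -> : 2^-1 + 2^-1 = 1 :> R by [lra]; rewrite sc1 mul1r.
  have -> : y = z + z - z * z by rewrite zz addrK.
  by rewrite mulrBl mul1r mulrBr mulr1 -addrA -opprD addrA.
- by move=> w wy; rewrite mulrBl mulrBr mul1r mulr1 (cz w wy).
Qed.

(** * Inverses and square roots of [sc t - y] by rescaling *)

Lemma invertible_sc r : r != 0 -> invertible (sc r).
Proof. by move=> r0; exists (sc r^-1); rewrite -!scM divff // mulVf // sc1. Qed.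

Lemma invertibleM (x y : A) : invertible x -> invertible y -> invertible (x * y).
Proof.
move=> [x' [xx' x'x]] [y' [yy' y'y]]; exists (y' * x'); split.
  by rewrite mulrA -(mulrA x) yy' mulr1.
by rewrite mulrA -(mulrA y') x'x mulr1.
Qed.

Lemma invertibleN (x : A) : invertible x -> invertible (- x).
Proof. by move=> [y [xy yx]]; exists (- y); rewrite !mulrNN. Qed.

Lemma sc_sub_factor t y : t != 0 -> sc t - y = sc t * (1 - sc t^-1 * y).
Proof. by move=> t0; rewrite mulrBr mulr1 mulrA -scM divff // sc1 mul1r. Qed.

Lemma nrm_scV_lt1 t y : nrm y < t -> nrm (sc t^-1 * y) < 1.
Proof.
move=> yt; have t0 := le_lt_trans (nrm_ge0 HA y) yt.
by rewrite nrm_scM gtr0_norm ?invr_gt0 // mulrC ltr_pdivrMr // mul1r.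
Qed.

Lemma invertible_sc_sub t y : nrm y < t -> invertible (sc t - y).
Proof.
move=> yt; have t0 := le_lt_trans (nrm_ge0 HA y) yt.
rewrite sc_sub_factor ?gt_eqF //; apply: invertibleM.
  by apply: invertible_sc; rewrite gt_eqF.
by apply: neumann; exact: nrm_scV_lt1.
Qed.

Lemma selfadjoint_sqrt t y : star y = y -> nrm y < t ->
  exists h, [/\ star h = h, h * h = sc t - y &
    forall z, z * y = y * z -> z * h = h * z].
Proof.
move=> sy yt; have t0 := le_lt_trans (nrm_ge0 HA y) yt.
have [||h [sh hh ch]] := @selfadjoint_sqrt1 (sc t^-1 * y).
- by rewrite (star_mul HA) star_sc sy sc_comm.
- exact: nrm_scV_lt1.
exists (sc (Num.sqrt t) * h); split.
- by rewrite (star_mul HA) star_sc sh sc_comm.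
- rewrite sc_sub_factor ?gt_eqF // -hh {2}sc_comm mulrA -(mulrA _ h) .
  rewrite -sc_comm -!mulrA [h * _]mulrA -sc_comm -!mulrA mulrA.
  by rewrite -scM -expr2 sqr_sqrtr ?ltW.
- move=> z zy; rewrite mulrA -sc_comm -!mulrA ch //.
  by rewrite mulrA -sc_comm -!mulrA zy.
Qed.

(** * The norm of a self-adjoint element seen in the spectrum of its square *)

Lemma comm_inverse (x y z : A) : x * y = 1 -> y * x = 1 -> z * x = x * z ->
  z * y = y * z.
Proof.
by move=> xy yx zx; rewrite -[LHS]mul1r -yx -mulrA (mulrA x) -zx -mulrA xy mulr1.
Qed.

Lemma star_inverse x y : x * y = 1 -> y * x = 1 -> star x = x -> star y = y.
Proof.
move=> xy yx sx; have := congr1 star xy; rewrite (star_mul HA) star1 sx => syx.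
by rewrite -[LHS]mulr1 -xy mulrA syx mul1r.
Qed.

Lemma nrm_sqr x : star x = x -> nrm (x * x) = nrm x ^+ 2.
Proof. by move=> sx; rewrite -(cstar_id HA) sx. Qed.

Lemma imag_sqr : 'i%C * 'i%C = -1 :> R[i].
Proof.
by apply/eqP; rewrite eq_complex /=; apply/andP; split; apply/eqP; ring.
Qed.

Lemma star_addi x k : star x = x -> star k = k -> star (x + 'i%C *: k) = x - 'i%C *: k.
Proof.
move=> sx sk; rewrite (star_add HA) (star_scale HA) sx sk -scaleNr.
by congr (_ + _ *: _); apply/eqP; rewrite eq_complex /= oppr0 !eqxx.
Qed.

Lemma star_addi_mul x k : star x = x -> star k = k -> x * k = k * x ->
  star (x + 'i%C *: k) * (x + 'i%C *: k) = x * x + k * k.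
Proof.
move=> sx sk xk; rewrite star_addi // mulrBl !mulrDr -!scalerAl -!scalerAr scalerA xk.
by rewrite imag_sqr scaleN1r opprD opprK addrA addrK.
Qed.

(* If k is a self-adjoint square root of s - x^2 commuting with x, then
   (x + ik)^*(x + ik) = s, and x is the real part of x + ik. *)
Lemma nrm_sqr_le_of_sqrt x k s : star x = x -> star k = k -> x * k = k * x ->
  k * k = sc s - x * x -> 0 <= s -> nrm x ^+ 2 <= s.
Proof.
move=> sx sk xk kk s0; pose u := x + 'i%C *: k.
have uu : star u * u = sc s by rewrite star_addi_mul // kk addrC subrK.
have nu : nrm u ^+ 2 = s by rewrite -(cstar_id HA) uu nrm_sc ger0_norm.
have xu : nrm x <= nrm u.
  have := nrm_add HA u (star u); rewrite nrm_star star_addi // addrACA subrr addr0.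
  by rewrite -mulr2n -scaler_nat -(rmorph_nat (real_complex R)) nrmZ normr_nat; lra.
by rewrite -nu ler_sqr ?nnegrE ?(nrm_ge0 HA).
Qed.

Lemma nrm_spectrum x : star x = x -> 0 < nrm x ->
  ~ invertible (sc (nrm x ^+ 2) - x * x).
Proof.
move=> sx x0 [w [_ wr]]; set q := nrm x ^+ 2 in wr.
have q0 : 0 < q by rewrite exprn_gt0.
have w0 := nrm_ge0 HA w.
(* Small enough for both e < q and 8e|w| <= 1; the summand 2 also keeps the denominator positive. *)
pose e := q / (8 * q * nrm w + 2).
have den : 0 < 8 * q * nrm w + 2 by rewrite ltr_wpDl ?mulr_ge0 // ltW.
have e0 : 0 < e by rewrite divr_gt0.
have eE : e * (8 * q * nrm w + 2) = q by rewrite divfK ?gt_eqF.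
clearbody e.
have lt_eq : e < q by nra.
have ew : 8 * (e * nrm w) <= 1 by nra.
have sxx : star (x * x) = x * x by rewrite (star_mul HA) sx.
have nxx : nrm (x * x) < q + e by rewrite nrm_sqr // ltrDl.
have [h [sh hh ch]] := selfadjoint_sqrt sxx nxx.
have [v [rv vr]] := invertible_sc_sub nxx.
have sv : star v = v by apply: star_inverse rv vr _; rewrite starB star_sc sxx.
(* Resolvent identity: [w] and [v] invert elements that differ by [sc e]. *)
have wv : w - v = sc e * (w * v).
  have -> : w - v = w * ((sc (q + e) - x * x) - (sc q - x * x)) * v.
    by rewrite mulrBr mulrBl -mulrA rv mulr1 wr mul1r.
  by rewrite opprB addrA subrK scD [sc q + _]addrC addrK -sc_comm mulrA.
(* From |v| <= |w| + e|w||v| and e|w| <= 1/8. Hence 2e|v| <= 1/2, so [1 - sc (2 * e) * v] has a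
   square root. *)
have nv : nrm v <= 2 * nrm w.
  have nwv : nrm (w - v) <= e * (nrm w * nrm v).
    by rewrite wv nrm_scM gtr0_norm // ler_wpM2l ?(nrm_mul HA) // ltW.
  have := nrm_add HA (v - w) w; rewrite subrK nrmB.
  have := nrm_ge0 HA v; nra.
have ne : nrm (sc (2 * e) * v) < 1.
  rewrite nrm_scM gtr0_norm ?mulr_gt0 //. have := ler_wpM2l (ltW e0) nv; lra.
have [|g [sg gg cg]] := selfadjoint_sqrt1 _ ne.
  by rewrite (star_mul HA) star_sc sv sc_comm.
have xh : x * h = h * x by apply: ch; rewrite mulrA.
have commv z : z * (x * x) = (x * x) * z -> z * v = v * z.
  by move=> zx; apply: comm_inverse rv vr _; rewrite mulrBr mulrBl sc_comm zx.
have commg z : z * (x * x) = (x * x) * z -> z * g = g * z.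
  by move=> zx; apply: cg; rewrite mulrA -sc_comm -!mulrA commv.
have hg : h * g = g * h by apply: commg; rewrite mulrA -xh -mulrA -xh mulrA.
have xg : x * g = g * x by apply: commg; rewrite mulrA.
(* Since h, g and x commute, (hg)^2 = (q + e - x^2)(1 - 2ev) = q - e - x^2. *)
have : q <= q - e.
  apply: (nrm_sqr_le_of_sqrt (k := h * g)) => //.
  - by rewrite (star_mul HA) sh sg hg.
  - by rewrite mulrA xh -!mulrA xg.
  - rewrite mulrA -(mulrA h) -hg !mulrA -mulrA gg hh mulrBr mulr1.
    rewrite mulrA -sc_comm -mulrA rv mulr1 addrAC -scB; congr (sc _ - _); ring.
  - lra.
lra.
Qed.

(** * Real spectrum, positivity and the order *)

Lemma invertible_sc_sub_norm t y : nrm y < `|t| -> invertible (sc t - y).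
Proof.
have [t0|t0] := leP 0 t; first by rewrite ger0_norm //; exact: invertible_sc_sub.
rewrite ltr0_norm // => yt.
have -> : sc t - y = - (sc (- t) - - y) by rewrite scN opprB opprK addrC.
by apply: invertibleN; apply: invertible_sc_sub; rewrite nrmN.
Qed.

Lemma invertibleZi (x : A) : invertible x -> invertible ('i%C *: x).
Proof.
have ii : 'i%C * - 'i%C = 1 :> R[i] by rewrite mulrN imag_sqr opprK.
move=> [y [xy yx]]; exists (- 'i%C *: y).
by rewrite -!scalerAl -!scalerAr !scalerA xy yx [- _ * _]mulrC ii scale1r.
Qed.

(* With q := p - a and b = Im lam, the element q + is has norm at most
   sqrt (|q|^2 + s^2), which is below |b + s| for the s chosen here. *)
Lemma invertible_sub_nonreal p (lam : R[i]) : star p = p ->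
  complex.Im lam != 0 -> invertible (p - lam *: 1).
Proof.
case: lam => a b /= sp b0; pose q := p - sc a.
have sq : star q = q by rewrite starB sp star_sc.
pose s := nrm q ^+ 2 / (2 * b); pose y := q + 'i%C *: sc s.
(* With this [s], (b + s)^2 exceeds |q|^2 + s^2 by exactly b^2 > 0. *)
have sb : 2 * b * s = nrm q ^+ 2.
  by rewrite mulrC divfK // mulf_neq0 // pnatr_eq0.
have yy : star y * y = q * q + sc (s * s).
  by rewrite star_addi_mul ?star_sc ?sc_comm // scM.
have y_lt : nrm y < `|b + s|.
  rewrite -ltr_sqr ?nnegrE ?normr_ge0 ?(nrm_ge0 HA) // real_normK ?num_real //.
  rewrite -(cstar_id HA) yy; apply: le_lt_trans (nrm_add HA _ _) _.
  rewrite nrm_sqr // nrm_sc ger0_norm -?expr2 ?sqr_ge0 //.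
  have : 0 < b ^+ 2 by rewrite exprn_even_gt0.
  rewrite sqrrD -sb mulr_natl; lra.
have -> : p - (a +i* b) *: 1 = 'i%C *: (sc (- (b + s)) - 'i%C *: y).
  rewrite scalerBr (scalerA _ _ y) imag_sqr scaleN1r opprK /y /q.
  rewrite [RHS]addrC -!addrA; congr (p + _); rewrite /sc !scalerA.
  rewrite -!scaleNr -!scalerDl; congr (_ *: _).
  by apply/eqP; rewrite eq_complex /=; apply/andP; split; apply/eqP; ring.
by apply: invertibleZi; apply: invertible_sc_sub_norm; rewrite normrN nrmZi.
Qed.

(** For real r < 0, p - r = (t - r) - (t - p) with |t - p| <= t < t - r. Together with the converse
    [cpos_nrm], this trades the spectral definition of positivity for a norm bound. *)
Lemma cpos_of_nrm p t : star p = p -> nrm (sc t - p) <= t -> cpos star p.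
Proof.
move=> sp pt; split=> // lam; apply: contra_notT => lam0.
have [im0|] := eqVneq (complex.Im lam) 0; last exact: invertible_sub_nonreal.
case: lam im0 lam0 => r s /= ->; rewrite lecE /= eqxx /= -ltNge => r0.
have -> : p - r%:C *: 1 = sc (t - r) - (sc t - p).
  by rewrite scB opprB [RHS]addrC addrA subrK.
by apply: invertible_sc_sub; lra.
Qed.

Lemma cpos_addr_invertible p r : cpos star p -> 0 < r -> invertible (p + sc r).
Proof.
move=> [sp posp] r0; apply: NNPP => ninv.
have : 0 <= (- r)%:C by apply: posp; rewrite raddfN /= scaleNr opprK.
by rewrite lecE /= eqxx oppr_ge0 leNgt r0.
Qed.

(** If t < |x|, then |x|^2 - x^2 = (|x| - x)(|x| + x) would be invertible, against
    [nrm_spectrum]. *)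
Lemma nrm_le_of_invertible x t : star x = x -> 0 <= t ->
  (forall s, t < s -> invertible (sc s - x) /\ invertible (sc s + x)) ->
  nrm x <= t.
Proof.
move=> sx t0 inv; rewrite leNgt; apply/negP => tx.
apply: (nrm_spectrum sx (le_lt_trans t0 tx)).
have [inv1 inv2] := inv _ tx.
have -> : sc (nrm x ^+ 2) - x * x = (sc (nrm x) - x) * (sc (nrm x) + x).
  rewrite mulrBl !mulrDr opprD addrA (sc_comm _ x) addrK.
  by rewrite -scM -expr2.
exact: invertibleM.
Qed.

Lemma cpos_nrm p t : cpos star p -> nrm p <= t -> nrm (sc t - p) <= t.
Proof.
move=> pos_p pt; have [sp _] := pos_p; have p0 := nrm_ge0 HA p.
apply: nrm_le_of_invertible; first by rewrite starB star_sc sp.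
  exact: le_trans pt.
move=> s ts; split.
  have -> : sc s - (sc t - p) = p + sc (s - t) by rewrite opprB scB addrCA.
  by apply: cpos_addr_invertible => //; lra.
by rewrite addrA -scD; apply: invertible_sc_sub; lra.
Qed.

(** Spectra do not add, but the bounds | |p| - p | <= |p| and | |q| - q | <= |q| do, by the triangle
    inequality. *)
Lemma cposD p q : cpos star p -> cpos star q -> cpos star (p + q).
Proof.
move=> pp pq; have := cpos_nrm pp (lexx _); have := cpos_nrm pq (lexx _).
move=> Hq Hp; apply: (@cpos_of_nrm _ (nrm p + nrm q)).
  by rewrite (star_add HA) pp.1 pq.1.
rewrite scD opprD addrACA; apply: le_trans (nrm_add HA _ _) _.
exact: lerD.
Qed.

Lemma nrm_le_sc p t : cpos star p -> cle star p (sc t) -> 0 <= t -> nrm p <= t.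
Proof.
move=> pp pt t0; apply: nrm_le_of_invertible => // [|s ts]; first exact: pp.1.
split; last by rewrite addrC; apply: cpos_addr_invertible => //; lra.
have -> : sc s - p = (sc t - p) + sc (s - t) by rewrite scB [RHS]addrC addrA subrK.
by apply: cpos_addr_invertible => //; lra.
Qed.

(** Transitivity through the scalar |q|: p is below q, and q is below |q|. *)
Lemma nrm_le_mono p q : cpos star p -> cle star p q -> nrm p <= nrm q.
Proof.
move=> pp pq; have q0 := nrm_ge0 HA q.
have posq : cpos star q by rewrite -(subrK p q); exact: cposD.
apply: nrm_le_sc => //; rewrite /cle -(subrK q (sc _)) -addrA.
apply: cposD => //; apply: (@cpos_of_nrm _ (nrm q)).
  by rewrite starB star_sc posq.1.
by rewrite opprB addrCA subrr addr0.
Qed.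

Lemma cgt0_sc e : 0 < e -> cgt0 star (sc e).
Proof.
move=> e0; split; last by apply: invertible_sc; rewrite gt_eqF.
by apply: (@cpos_of_nrm _ e); rewrite ?star_sc // subrr nrm0 ltW.
Qed.

(** For t > |eps|, positivity gives |t - eps| <= t and invertibility makes this strict; the gap is
    the radius sought. *)
Lemma cgt0_lower_bound eps : cgt0 star eps ->
  exists2 e, 0 < e & forall p, star p = p -> nrm p <= e -> cle star p eps.
Proof.
move=> [pe inve]; have n0 := nrm_ge0 HA eps.
pose t := nrm eps + 1.
have st : star (sc t - eps) = sc t - eps by rewrite starB star_sc pe.1.
have xt : nrm (sc t - eps) <= t by apply: cpos_nrm => //; rewrite /t; lra.
have xt' : nrm (sc t - eps) < t.
  rewrite lt_neqAle xt andbT; apply/eqP => xE.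
  have t0 : 0 < t by rewrite /t; lra.
  apply: (@nrm_spectrum (sc t - eps)) => //; rewrite xE //.
  (* Equality |t - eps| = t would contradict [nrm_spectrum]: both factors are invertible, the second
     because |eps| < 2t. *)
  have -> : sc (t ^+ 2) - (sc t - eps) * (sc t - eps) = eps * (sc (t + t) - eps).
    rewrite expr2 scM scD mulrBl !mulrBr mulrDr (sc_comm _ eps).
    by rewrite !opprB [LHS]addrC -addrA subrK addrAC.
  apply: invertibleM => //; apply: invertible_sc_sub; rewrite /t; lra.
exists (t - nrm (sc t - eps)); first by rewrite subr_gt0.
move=> p sp pn; apply: (@cpos_of_nrm _ t); first by rewrite starB sp pe.1.
rewrite opprB addrCA addrC; apply: le_trans (nrm_add HA _ _) _; lra.
Qed.

(** * The contraction principle for the real asymmetric metric *)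

Section ContractionPrinciple.
Variables (X : Type) (d : X -> X -> A) (T : X -> X).
Hypothesis dmetric : asym_metric star d.

Let D x y := nrm (d x y).

Lemma nrm_metric_eq0 x y : D x y = 0 -> x = y.
Proof. by move/(nrm_eq0 HA)/dmetric.2.1. Qed.

Lemma nrm_metric_xx x : D x x = 0.
Proof. by rewrite /D ((dmetric.2.1 x x).2 erefl) nrm0. Qed.

Lemma nrm_metric_triangle x y z : D x y <= D x z + D z y.
Proof.
apply: le_trans (nrm_add HA _ _); apply: nrm_le_mono; first exact: dmetric.1.
exact: dmetric.2.2.
Qed.

Lemma fwd_conv_nrm u x : fwd_conv star d u x ->
  forall e, 0 < e -> exists N, forall n, (N <= n)%N -> D x (u n) <= e.
Proof.
move=> ux e e0; have [N HN] := ux _ (cgt0_sc e0).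
by exists N => n /HN xn; apply: nrm_le_sc (ltW e0) => //; exact: dmetric.1.
Qed.

Lemma bwd_conv_nrm u x : bwd_conv star d u x ->
  forall e, 0 < e -> exists N, forall n, (N <= n)%N -> D (u n) x <= e.
Proof.
move=> ux e e0; have [N HN] := ux _ (cgt0_sc e0).
by exists N => n /HN xn; apply: nrm_le_sc (ltW e0) => //; exact: dmetric.1.
Qed.

Lemma nrm_fwd_cauchy u :
  (forall e, 0 < e -> exists N, forall p n, (N <= p)%N -> (p <= n)%N ->
    D (u p) (u n) < e) -> fwd_cauchy star d u.
Proof.
move=> cu eps /cgt0_lower_bound [e e0 He]; have [N HN] := cu e e0.
exists N => n p Np pn; apply: He; first exact: (dmetric.1 _ _).1.
by apply/ltW/HN => //; exact: ltnW.
Qed.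

Lemma nrm_bwd_cauchy u :
  (forall e, 0 < e -> exists N, forall p n, (N <= p)%N -> (p <= n)%N ->
    D (u n) (u p) < e) -> bwd_cauchy star d u.
Proof.
move=> cu eps /cgt0_lower_bound [e e0 He]; have [N HN] := cu e e0.
exists N => n p Np pn; apply: He; first exact: (dmetric.1 _ _).1.
by apply/ltW/HN => //; exact: ltnW.
Qed.

Lemma fwd_contraction_nrm : fwd_contraction star nrm d T ->
  exists k, [/\ 0 <= k, k < 1 & forall x y, D (T x) (T y) <= k * D x y].
Proof.
move=> [a [a1 Ha]]; have a0 := nrm_ge0 HA a.
(* The two outer factors contribute |a^*| |a| = |a|^2. *)
exists (nrm a ^+ 2); split; first exact: sqr_ge0.
  by rewrite expr_lt1.
move=> x y; apply: le_trans (nrm_le_mono (dmetric.1 _ _) (Ha x y)) _.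
apply: le_trans (nrm_mul HA _ _) _; rewrite expr2 mulrAC.
by rewrite ler_wpM2r // -(nrm_star a); exact: (nrm_mul HA).
Qed.

Lemma contraction_unique_fixpoint k (x0 : X) : 0 <= k -> k < 1 ->
  (forall x y, D (T x) (T y) <= k * D x y) -> complete_space star d ->
  exists x : X, T x = x /\ forall y : X, T y = y -> y = x.
Proof.
move=> k0 k1 Tk [fcomp bcomp].
have D0 x y : 0 <= D x y by exact: (nrm_ge0 HA).
pose u n := iter n T x0.
(* Without symmetry, forward and backward steps need separate initial constants but share the ratio
   [k]. *)
have fstep n : D (u n) (u n.+1) <= D x0 (T x0) * k ^+ n.
  elim: n => [|n IH]; first by rewrite expr0 mulr1.
  by apply: le_trans (Tk _ _) _; rewrite exprS mulrCA ler_wpM2l.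
have bstep n : D (u n.+1) (u n) <= D (T x0) x0 * k ^+ n.
  elim: n => [|n IH]; first by rewrite expr0 mulr1.
  by apply: le_trans (Tk _ _) _; rewrite exprS mulrCA ler_wpM2l.
have [x fx] : exists x, fwd_conv star d u x.
  apply/fcomp/nrm_fwd_cauchy.
  apply: (@geometric_cauchy R (fun p n => D (u p) (u n)) k _ k0 k1 (D0 x0 (T x0))).
    by move=> p; exact: nrm_metric_xx.
  move=> p n _; apply: le_trans (nrm_metric_triangle _ _ (u n)) _.
  by rewrite lerD2l.
have [y bx] : exists y, bwd_conv star d u y.
  apply/bcomp/nrm_bwd_cauchy.
  apply: (@geometric_cauchy R (fun p n => D (u n) (u p)) k _ k0 k1 (D0 (T x0) x0)).
    by move=> p; exact: nrm_metric_xx.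
  move=> p n _; apply: le_trans (nrm_metric_triangle _ _ (u n)) _.
  by rewrite addrC lerD2l.
have eq_of_small z w : (forall e, 0 < e -> D z w <= e) -> z = w.
  move=> Hzw; apply: nrm_metric_eq0; apply/eqP; rewrite eq_le D0 andbT.
  by apply/ler_addgt0Pl => e e0; rewrite addr0 Hzw.
have xy : x = y.
  apply: eq_of_small => e e0; have e2 : 0 < e / 2 by rewrite divr_gt0.
  have [N HN] := fwd_conv_nrm fx e2; have [M HM] := bwd_conv_nrm bx e2.
  have := HN _ (leq_maxl N M); have := HM _ (leq_maxr N M).
  have := nrm_metric_triangle x y (u (maxn N M)); lra.
rewrite -{y}xy in bx.
have Tx : T x = x.
  apply: eq_of_small => e e0; have e2 : 0 < e / 2 by rewrite divr_gt0.
  have [N HN] := fwd_conv_nrm fx e2; have [M HM] := bwd_conv_nrm bx e2.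
  (* With m = max(N, M), D(Tx, x) <= k D(x, u_m) + D(u_(m+1), x): the first term uses forward
     convergence at m, the second backward convergence at m + 1. *)
  have := HN _ (leq_maxl N M); have := HM _ (leqW (leq_maxr N M)).
  have := nrm_metric_triangle (T x) x (u (maxn N M).+1).
  have := Tk x (u (maxn N M)); have := D0 x (u (maxn N M)).
  rewrite [u (maxn N M).+1]/=; nra.
exists x; split=> // y Ty; apply: nrm_metric_eq0.
(* D(y, x) <= k D(y, x) with k < 1 forces D(y, x) = 0. *)
have := Tk y x; rewrite Ty Tx; have := D0 y x; nra.
Qed.

End ContractionPrinciple.

End CStarTheory.

Theorem mainTheorem2 (R : realType) (A : algType R[i]) (star : A -> A)
  (nrm : A -> R) (X : Type) (d : X -> X -> A) (T : X -> X) :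
  is_unital_CStar star nrm ->
  inhabited X ->
  asym_metric star d ->
  complete_space star d ->
  fwd_contraction star nrm d T ->
  exists x : X, T x = x /\ forall y : X, T y = y -> y = x.
Proof.
move=> HA [x0] dm dc /(fwd_contraction_nrm HA dm) [k [k0 k1 Tk]].
exact: (contraction_unique_fixpoint HA dm x0 k0 k1 Tk dc).
Qed.
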